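(* Let $\Gamma$ be an abstract Euclidean cristallographic group, with exact sequence $0\to\Lambda\to\Gamma\to G\to1$. For each field $K\supset\mathbb Z$ there is a unique class of affine realizations of $\Gamma$ defined over $K$; that is, an affine realization of $\Gamma$ defined over $K$ exists, and any two are conjugate by a translation of $\Lambda\otimes_{\mathbb Z}K$. Moreover, there is an effectively computable minimal positive integer $d$ such that the realization (i.e. some representative of its class) is obtained via the lattice $\frac1d\Lambda$.
   Context: **Abstract Euclidean cristallographic group.** A group $\Gamma$ for which there is an exact sequence $0\to\Lambda\to\Gamma\to G\to 1$ where (1) $G$ is a finite group; (2) $\Lambda$ is free abelian of finite rank $r$; (3) the conjugation homomorphism $Ad:\Gamma\to \mathrm{Aut}(\Lambda)$, $Ad(\gamma)(\lambda)=\gamma\lambda\gamma^{-1}$, has kernel exactly $\Lambda$, hence induces an embedding $L:G\to GL(\Lambda)=\mathrm{Aut}(\Lambda)$. The sequence is determined by $\Gamma$ up to isomorphism. **Affine realization over $K$.** For a field $K\supset\mathbb Z$ (i.e. of characteristic zero), put $V_K:=\Lambda\otimes_{\mathbb Z}K$ and extend $L(g)$ to $V_K$ as $L(g)\otimes \mathrm{Id}_K$. An affine realization of $\Gamma$ defined over $K$ is a homomorphism (necessarily injective) $\rho:\Gamma\to \mathrm{Aff}(V_K)$ into the group of affine transformations of $V_K$ such that: [1] $\rho(\lambda)(v)=v+\lambda$ for all $\lambda\in\Lambda$, $v\in V_K$; [2] for every $g\in G$ and every lift $\gamma\in\Gamma$ of $g$, $\rho(\gamma)(v)=L(g)v+u_\gamma$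 for some $u_\gamma\in V_K$. **Class.** Two affine realizations are in the same class if they are conjugate by a translation of $V_K$ (equivalently, the 1-cocycles $(u_\gamma)\in Z^1(\Gamma,V_K)$ are cohomologous). **Realization obtained via a lattice.** An affine realization $\rho$ is obtained via a lattice $\Lambda'\subset\Lambda\otimes_{\mathbb Z}\mathbb Q$ if there exists a homomorphism $\rho':\Gamma\to \mathrm{Aff}(\Lambda')$ such that $\rho=\rho'\otimes_{\mathbb Z}K$ (then necessarily $\Lambda\subset\Lambda'$); for $\Lambda'=\frac1d\Lambda$ this amounts to all $u_\gamma$ lying in $\Lambda'$. **Effectively computable.** This means computable by an algorithm from the finite data determining $\Gamma$: the finite group $G$, the integral representation $L$, and a 2-cocycle for the extension. *)

(* Defs.v *)
From mathcomp Require Import all_boot all_order all_algebra all_fingroup.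

Set Implicit Arguments.
Unset Strict Implicit.
Unset Printing Implicit Defensive.

Import GRing.Theory.
Local Open Scope ring_scope.

(* An abstract Euclidean cristallographic group Gamma, with its exact sequence
   0 -> Lambda -> Gamma -> G -> 1.  The free abelian group Lambda of rank r is
   Z^r, embedded by iota; iota thus includes an arbitrary choice of basis. *)
Record crystal (r : nat) (Gamma : groupType) (G : finGroupType) := Crystal {
  iota : 'cV[int]_r -> Gamma;
  proj : Gamma -> G;
  iotaD : forall a b : 'cV[int]_r, iota (a + b) = (iota a * iota b)%g;
  iota_inj : injective iota;
  projM : forall x y : Gamma, proj (x * y)%g = (proj x * proj y)%g;
  proj_surj : forall g : G, exists x : Gamma, proj x = g;
  proj_ker : forall x : Gamma,
    proj x = 1%g <-> exists a : 'cV[int]_r, x = iota a;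
  Ad_ker : forall x : Gamma,
    (forall a : 'cV[int]_r, (x * iota a * x^-1)%g = iota a) <->
    exists a : 'cV[int]_r, x = iota a
}.

Section Holonomy.
Variables (r : nat) (Gamma : groupType) (G : finGroupType).
Variable c : crystal r Gamma G.

Lemma proj_surjb (g : G) : exists x : Gamma, proj c x == g.
Proof. by have [x <-] := proj_surj c g; exists x. Qed.

Definition sec (g : G) : Gamma := xchoose (proj_surjb g).

Lemma secP (g : G) : proj c (sec g) = g.
Proof. exact/eqP/(xchooseP (proj_surjb g)). Qed.

Lemma projg1 : proj c 1%g = 1%g.
Proof. by apply: (mulgI (proj c 1%g)); rewrite -projM !mulg1. Qed.

Lemma projV (x : Gamma) : proj c x^-1%g = (proj c x)^-1%g.
Proof. by apply: (mulgI (proj c x)); rewrite -projM !mulgV projg1. Qed.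

Lemma Ad_subproof (x : Gamma) (a : 'cV[int]_r) :
  exists b : 'cV[int]_r, iota c b == (x * iota c a * x^-1)%g.
Proof.
have /(proj_ker c)[b ->] : proj c (x * iota c a * x^-1)%g = 1%g; last by exists b.
have pa : proj c (iota c a) = 1%g by apply/proj_ker; exists a.
by rewrite !projM pa projV mulg1 mulgV.
Qed.

Definition Ad (x : Gamma) (a : 'cV[int]_r) : 'cV[int]_r :=
  xchoose (Ad_subproof x a).

Lemma AdP (x : Gamma) (a : 'cV[int]_r) :
  iota c (Ad x a) = (x * iota c a * x^-1)%g.
Proof. exact/eqP/(xchooseP (Ad_subproof x a)). Qed.

(* The matrix of L(g) in the standard basis of Z^r. *)
Definition hol (g : G) : 'M[int]_r :=
  \matrix_(i, j) Ad (sec g) (delta_mx j 0) i 0.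

Lemma AdD (x : Gamma) (a b : 'cV[int]_r) : Ad x (a + b) = Ad x a + Ad x b.
Proof.
apply: (@iota_inj _ _ _ c); rewrite AdP !iotaD !AdP.
by rewrite !mulgA -[(_ * x^-1 * x)%g]mulgA mulVg mulg1.
Qed.

Lemma Ad_indep (x y : Gamma) (a : 'cV[int]_r) :
  proj c x = proj c y -> Ad x a = Ad y a.
Proof.
move=> exy; apply: (@iota_inj _ _ _ c); rewrite !AdP.
have /(proj_ker c)[b eb] : proj c (y^-1 * x)%g = 1%g.
  by rewrite projM projV exy mulVg.
have -> : x = (y * iota c b)%g by rewrite -eb mulgA mulgV mul1g.
rewrite invgM -!mulgA; congr (_ * _)%g; rewrite !mulgA; congr (_ * _)%g.
by rewrite -iotaD addrC iotaD -mulgA mulgV mulg1.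
Qed.

Lemma holP (x : Gamma) (a : 'cV[int]_r) :
  iota c (hol (proj c x) *m a) = (x * iota c a * x^-1)%g.
Proof.
pose f := Ad x.
have fD b b' : f (b + b') = f b + f b' by exact: AdD.
have f0 : f 0 = 0 by apply: (addrI (f 0)); rewrite -fD !addr0.
have fN b : f (- b) = - f b by apply: (addrI (f b)); rewrite -fD !subrr f0.
have fMn b n : f (b *+ n) = f b *+ n.
  by elim: n => [|n IH]; rewrite ?f0 // !mulrS fD IH.
have fZ (z : int) b : f (z *: b) = z *: f b.
  by case: z => n; rewrite ?NegzE ?scaleNr ?fN -!natz !scaler_nat fMn.
rewrite -AdP -/f; congr (iota c _).
have -> : a = \sum_j a j 0 *: delta_mx j 0.
  by rewrite [LHS]matrix_sum_delta; apply: eq_bigr => j _; rewrite big_ord1.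
rewrite mulmx_sumr (big_morph f fD f0); apply: eq_bigr => j _.
rewrite -scalemxAr fZ -colE; congr (_ *: _); apply/colP => i.
by rewrite !mxE -[in LHS](Ad_indep (x := x)) ?secP.
Qed.

End Holonomy.

(* The group Aff(K^r), its elements acting by v |-> A v + b. *)
Record aff (K : fieldType) (r : nat) := Aff {
  alin : 'M[K]_r;
  atr : 'cV[K]_r;
  alin_unit : alin \in unitmx
}.

Definition aff_app (K : fieldType) (r : nat) (f : aff K r) (v : 'cV[K]_r) :
  'cV[K]_r := alin f *m v + atr f.
Coercion aff_app : aff >-> Funclass.

Definition aff_hom (K : fieldType) (r : nat) (Gamma : groupType)
    (rho : Gamma -> aff K r) : Prop :=
  forall (x y : Gamma) (v : 'cV[K]_r), rho (x * y)%g v = rho x (rho y v).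

(* Lambda (x) K is K^r, a in Lambda being identified with map_mx intr a, and
   L(g) (x) Id_K is the matrix L(g) read in K. *)
Definition affine_realization (r : nat) (Gamma : groupType) (G : finGroupType)
    (c : crystal r Gamma G) (K : fieldType) (rho : Gamma -> aff K r) : Prop :=
  [/\ aff_hom rho,
      forall (a : 'cV[int]_r) (v : 'cV[K]_r),
        rho (iota c a) v = v + map_mx intr a
    & forall x : Gamma, exists u : 'cV[K]_r, forall v : 'cV[K]_r,
        rho x v = map_mx intr (hol c (proj c x)) *m v + u].

Definition same_class (r : nat) (Gamma : groupType) (K : fieldType)
    (rho1 rho2 : Gamma -> aff K r) : Prop :=
  exists w : 'cV[K]_r, forall (x : Gamma) (v : 'cV[K]_r),
    rho2 x v = rho1 x (v - w) + w.

(* The lattice (1/d) Lambda inside Lambda (x) Q, for d > 0. *)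
Definition inv_lattice (r d : nat) (v : 'cV[rat]_r) : Prop :=
  exists a : 'cV[int]_r, v = d%:R^-1 *: map_mx intr a.

(* For a lattice M of Lambda (x) Q, the affine transformations of M are the
   restrictions of the affine transformations of Lambda (x) Q that map M onto
   itself.  Tensoring with K reads the coefficients of the latter in K. *)
Definition obtained_via (r : nat) (Gamma : groupType) (K : fieldType)
    (M : 'cV[rat]_r -> Prop) (rho : Gamma -> aff K r) : Prop :=
  exists rho' : Gamma -> aff rat r,
    [/\ aff_hom rho',
        forall (x : Gamma) (v : 'cV[rat]_r), M (rho' x v) <-> M v
      & forall (x : Gamma) (v : 'cV[K]_r),
          rho x v = map_mx ratr (alin (rho' x)) *m v
                    + map_mx ratr (atr (rho' x))].

Definition class_obtained_via (r : nat) (Gamma : groupType) (K : fieldType)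
    (d : nat) (rho : Gamma -> aff K r) : Prop :=
  exists rho1 : Gamma -> aff K r,
    same_class rho rho1 /\ obtained_via (@inv_lattice r d) rho1.

Definition minimal_denominator (r : nat) (Gamma : groupType) (K : fieldType)
    (rho : Gamma -> aff K r) (d : nat) : Prop :=
  [/\ (0 < d)%N, class_obtained_via d rho
    & forall d' : nat, (0 < d')%N -> class_obtained_via d' rho -> (d <= d')%N].

(* The total recursive functions: the smallest class containing zero, successor
   and projections, closed under composition, primitive recursion and
   minimization of regular functions (functions that always have a zero in
   their first argument). *)
Inductive recursive : forall n : nat, (n.-tuple nat -> nat) -> Prop :=
| rec_zero n : @recursive n (fun _ => 0%N)
| rec_succ : @recursive 1 (fun t => (thead t).+1)
| rec_proj n (i : 'I_n) : @recursive n (fun t => tnth t i)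
| rec_comp m n (f : m.-tuple nat -> nat) (g : 'I_m -> n.-tuple nat -> nat) :
    recursive f -> (forall i, recursive (g i)) ->
    @recursive n (fun t => f [tuple g i t | i < m])
| rec_prim n (f : n.-tuple nat -> nat) (g : n.+2.-tuple nat -> nat)
    (h : n.+1.-tuple nat -> nat) :
    recursive f -> recursive g ->
    (forall t : n.-tuple nat, h (cons_tuple 0%N t) = f t) ->
    (forall k (t : n.-tuple nat), h (cons_tuple k.+1 t) =
       g (cons_tuple k (cons_tuple (h (cons_tuple k t)) t))) ->
    recursive h
| rec_min n (f : n.+1.-tuple nat -> nat) (h : n.-tuple nat -> nat) :
    recursive f ->
    (forall t : n.-tuple nat, f (cons_tuple (h t) t) = 0%N) ->
    (forall (t : n.-tuple nat) k, (k < h t)%N ->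
       f (cons_tuple k t) <> 0%N) ->
    recursive h.

Definition computable (Phi : nat -> nat) : Prop :=
  @recursive 1 (fun t => Phi (thead t)).

(* The finite data determining Gamma: the multiplication table of G, whose
   elements are numbered 0, ..., n-1; the integral representation L; a 2-cocycle
   of the extension. *)
Record cryst_data := CrystData {
  dcard : nat;
  drank : nat;
  dmul : 'I_dcard -> 'I_dcard -> 'I_dcard;
  drep : 'I_dcard -> 'M[int]_drank;
  dcoc : 'I_dcard -> 'I_dcard -> 'cV[int]_drank
}.

(* D is read off c from a numbering of G and a set-theoretic section s of
   Gamma -> G, not required to preserve 1; the cocycle is
   s(g) s(h) s(gh)^-1. *)
Definition presented_by (r : nat) (Gamma : groupType) (G : finGroupType)
    (c : crystal r Gamma G) (D : cryst_data) : Prop :=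
  exists (er : drank D = r) (num : 'I_(dcard D) -> G)
         (s : 'I_(dcard D) -> Gamma),
    [/\ bijective num,
        forall i, proj c (s i) = num i,
        forall i j, num (dmul i j) = (num i * num j)%g,
        forall i, castmx (er, er) (drep i) = hol c (num i)
      & forall i j, iota c (castmx (er, erefl) (dcoc i j)) =
          (s i * s j * (s (dmul i j))^-1)%g].

Definition code_int (z : int) : nat :=
  match z with Posz n => n.*2 | Negz n => n.*2.+1 end.

Definition code_matrix (m n : nat) (A : 'M[int]_(m, n)) : seq nat :=
  [seq code_int (A i j) | i <- enum 'I_m, j <- enum 'I_n].

Definition code_data (D : cryst_data) : nat :=
  let I := enum 'I_(dcard D) in
  CodeSeq.code
    ([:: dcard D; drank D]
     ++ [seq nat_of_ord (dmul i j) | i <- I, j <- I]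
     ++ flatten [seq code_matrix (drep i) | i <- I]
     ++ flatten [seq code_matrix (dcoc i j) | i <- I, j <- I]).

Lemma presented_exists (r : nat) (Gamma : groupType) (G : finGroupType)
    (c : crystal r Gamma G) : exists D : cryst_data, presented_by c D.
Proof.
pose x (i j : 'I_#|G|) : Gamma := (sec c (enum_val i) * sec c (enum_val j)
  * (sec c (enum_val (enum_rank (enum_val i * enum_val j)%g)))^-1)%g.
have exc i j : exists a : 'cV[int]_r, iota c a == x i j.
  have /(proj_ker c)[a ->] : proj c (x i j) = 1%g; last by exists a.
  by rewrite /x !projM projV !secP enum_rankK mulgV.
exists (@CrystData #|G| r
  (fun i j => enum_rank (enum_val i * enum_val j)%g)
  (fun i => hol c (enum_val i)) (fun i j => xchoose (exc i j))).
exists erefl, enum_val, (fun i => sec c (enum_val i)); split=> /=.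
- exact: enum_val_bij.
- by move=> i; rewrite secP.
- by move=> i j; rewrite enum_rankK.
- by move=> i; rewrite castmx_id.
- by move=> i j; rewrite castmx_id; apply/eqP/(xchooseP (exc i j)).
Qed.

(* Main.v *)
Require Import Defs.
From Stdlib Require Import FunctionalExtensionality.
From mathcomp Require Import all_boot all_order all_algebra all_fingroup.
From mathcomp Require Import zify ring.

(** Everything is reduced to integral 1-cocycles.  An affine realization is a
    homomorphism [x |-> (v |-> L(x) v + u x)], so [u] is a 1-cocycle of [Gamma]
    with values in [V_K] that restricts to the inclusion on [Lambda].

    Uniqueness: the difference of two such [u] vanishes on [Lambda], hence is a
    cocycle of the finite group [G]; averaging it over [G] exhibits it as a
    coboundary, because [#|G|] is invertible in [K]
    ([realizations_same_class]).

    Denominators: clearing the denominator [d] turns a realization via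
    [(1/d) Lambda] into a cocycle [Gamma -> Lambda] that restricts to
    multiplication by [d] on [Lambda], and conversely
    ([class_obtained_viaP]).  This condition no longer mentions [K]; it says that
    [d] kills the class of the extension in [H^2(G, Lambda)].

    Computability: the condition asks for the solvability over [Z] of the linear
    system [t_i + L_i t_j - t_(ij) = d f_ij], [f] being the given 2-cocycle, and
    a search over [Z] need not stop.  But [#|G|] annihilates [H^2(G, Lambda)],
    so, by the exact sequence of multiplication by [#|G|] on [Lambda], the map
    [H^2(G, Lambda) -> H^2(G, Lambda/#|G|Lambda)] is injective, and solvability
    modulo [#|G|] suffices.  The explicit form of this argument is
    [scaling_cocycle_mod]: the defect of a solution modulo [#|G|] is [#|G|] times
    a 2-cocycle, and summing that 2-cocycle over [G] gives the correction.  The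
    same lemma, applied to [t = 0] and [d = #|G|], gives the existence of a
    realization and the bound [d <= #|G|].

    The minimal [d] is therefore found by trying the finitely many [d] in
    [1 .. #|G|] and, for each, the finitely many [t] modulo [#|G|].  Such a
    search is primitive recursive once the data are decoded arithmetically from
    their code, which is what [computable_min_denominator] and [kills_classP]
    establish. *)

Set Implicit Arguments.
Unset Strict Implicit.
Unset Printing Implicit Defensive.

Import GRing.Theory Num.Theory.
Local Open Scope ring_scope.

(** * Integral cocycles and their reduction modulo the order of G *)

(** The equation [partial t = d f] for the 2-cocycle [f] of [D], modulo the order
    of the finite group. *)
Definition mod_solution (D : cryst_data) (d : nat)
    (t : 'I_(dcard D) -> 'cV[int]_(drank D)) : Prop :=
  forall i j k,
    ((dcard D)%:Z
       %| (t i + drep i *m t j - t (dmul i j) - dcoc i j *+ d)%R k 0%R)%Z.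

Lemma mulmxMn (R : pzRingType) m n p (A : 'M[R]_(m, n)) (B : 'M_(n, p)) k :
  A *m (B *+ k) = (A *m B) *+ k.
Proof. exact: (raddfMn (mulmx A)). Qed.

Lemma mulmx_ext (R : pzRingType) m n (A B : 'M[R]_(m, n)) :
  (forall v : 'cV_n, A *m v = B *m v) -> A = B.
Proof.
move=> eqAB; apply/matrixP => i j.
by have /colP/(_ i) := eqAB (delta_mx j 0); rewrite -!colE !mxE.
Qed.

Lemma col_natmulI m n : (0 < n)%N -> injective (fun a : 'cV[int]_m => a *+ n).
Proof.
move=> n_gt0 a b /colP eqab; apply/colP => i; apply: (pmulrnI n_gt0).
by have := eqab i; rewrite !mulmxnE.
Qed.

Lemma addcolE m (a b : 'cV[int]_m) i : (a + b) i 0 = a i 0 + b i 0.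
Proof. by rewrite mxE. Qed.
Lemma oppcolE m (a : 'cV[int]_m) i : (- a) i 0 = - a i 0.
Proof. by rewrite mxE. Qed.
(** Identities in the abelian group of integral column vectors, which is not a
    ring, are checked entry by entry. *)
Ltac col_abel := apply/colP => ?; rewrite ?(addcolE, oppcolE, mulmxnE); ring.

Section Crystal.
Variables (r : nat) (Gamma : groupType) (G : finGroupType).
Variable c : crystal r Gamma G.

Local Notation p := (proj c).
Local Notation i_ := (Defs.iota c).
Local Notation L x := (hol c (proj c x)).

Lemma iota0 : i_ 0 = 1%g.
Proof. by apply: (mulgI (i_ 0)); rewrite -Defs.iotaD addr0 mulg1. Qed.

Lemma proj_iota a : p (i_ a) = 1%g.
Proof. by apply/proj_ker; exists a. Qed.

Lemma hol1 : hol c 1%g = 1%:M.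
Proof.
apply: mulmx_ext => v; apply: (iota_inj (c := c)).
by rewrite -(projg1 c) holP invg1 mulg1 mul1g mul1mx.
Qed.

Lemma holM g h : hol c (g * h)%g = hol c g *m hol c h.
Proof.
have [x <-] := proj_surj c g; have [y <-] := proj_surj c h.
apply: mulmx_ext => v; apply: (iota_inj (c := c)).
by rewrite -projM -mulmxA !holP invgM !mulgA.
Qed.

Lemma iota_conj x a : (x * i_ a)%g = (i_ (L x *m a) * x)%g.
Proof. by rewrite holP mulgKV. Qed.

Lemma same_proj x y : p x = p y -> exists a, x = (i_ a * y)%g.
Proof.
move=> pxy; have /(proj_ker c)[a xy] : p (x * y^-1)%g = 1%g.
  by rewrite projM projV pxy mulgV.
by exists a; rewrite -xy mulgKV.
Qed.

Lemma card_holonomy_gt0 : (0 < #|G|)%N.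
Proof. by apply/card_gt0P; exists 1%g. Qed.

(** This is what makes averages over [G] work on the level of [Gamma]: [f] is a
    function on [G] in disguise, and left multiplication permutes [G]. *)
Lemma sum_sec_shift (V : nmodType) (f : Gamma -> V) x :
    (forall a y, f (i_ a * y)%g = f y) ->
  \sum_(g : G) f (x * sec c g)%g = \sum_(g : G) f (sec c g).
Proof.
move=> f_iota; rewrite [RHS](reindex_inj (mulgI (p x))) /=.
apply: eq_bigr => g _.
have [|a ->] := @same_proj (x * sec c g)%g (sec c (p x * g)%g) => //.
by rewrite projM !secP.
Qed.

(** For [d > 0], these are the translation parts of the realizations via
    [(1/d) Lambda], multiplied by [d].  One exists exactly when [d] times the
    class of the extension vanishes in [H^2(G, Lambda)]. *)
Definition scaling_cocycle d (u : Gamma -> 'cV[int]_r) : Prop :=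
  (forall x y, u (x * y)%g = u x + L x *m u y) /\ (forall a, u (i_ a) = a *+ d).

(** Let [#|G| e] be the defect of [u].  Since [Lambda] has no torsion, [e] is a
    2-cocycle, and it only depends on the images of its arguments in [G].
    Summing the cocycle identity of [e] over its last argument shows that
    [#|G| e] is the coboundary of [E x = \sum_g e(x, g)], so that [u - E] is a
    cocycle; [E] is constant on the cosets of [Lambda] and does not disturb the
    values on [Lambda]. *)
Lemma scaling_cocycle_mod d (u : Gamma -> 'cV[int]_r) :
    (forall a x, u (i_ a * x)%g = a *+ d + u x) ->
    (forall x y, exists e, u x + L x *m u y = u (x * y)%g + e *+ #|G|) ->
  exists u', scaling_cocycle d u'.
Proof.
move=> u_iota u_mod.
have n_gt0 := card_holonomy_gt0.
have exe x y : exists e, u x + L x *m u y == u (x * y)%g + e *+ #|G|.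
  by have [e ->] := u_mod x y; exists e.
pose e x y := xchoose (exe x y).
have eP x y : e x y *+ #|G| = u x + L x *m u y - u (x * y)%g.
  by rewrite (eqP (xchooseP (exe x y))) addrC addKr.
have e_iotar x y a : e x (i_ a * y)%g = e x y.
  apply: (col_natmulI n_gt0); rewrite /= !eP mulgA iota_conj -mulgA !u_iota.
  by rewrite mulmxDr mulmxMn; col_abel.
have e_iotal x y a : e (i_ a * x)%g y = e x y.
  apply: (col_natmulI n_gt0); rewrite /= !eP -mulgA !u_iota.
  by rewrite projM proj_iota mul1g; col_abel.
have e_coc x y z : L x *m e y z + e x (y * z)%g = e (x * y)%g z + e x y.
  apply: (col_natmulI n_gt0); rewrite /= !mulrnDl -mulmxMn !eP.
  rewrite !mulmxDr mulmxN !mulmxA -holM -projM mulgA.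
  by col_abel.
pose E x := \sum_(g : G) e x (sec c g).
have E_coc x y : E (x * y)%g + e x y *+ #|G| = E x + L x *m E y.
  have <- : \sum_(g : G) e x (y * sec c g)%g = E x.
    by apply: sum_sec_shift => a z; apply: e_iotar.
  rewrite /E mulmx_sumr -sumr_const -!big_split /=.
  by apply: eq_bigr => g _; rewrite -e_coc addrC.
have defect x y : u x - E x + L x *m (u y - E y) = u (x * y)%g - E (x * y)%g.
  have -> : E (x * y)%g = E x + L x *m E y - e x y *+ #|G|.
    by rewrite -E_coc addrK.
  by rewrite eP mulmxBr; col_abel.
have E_iota a x : E (i_ a * x)%g = E x.
  by apply: eq_bigr => g _; apply: e_iotal.
(* The value on [Lambda] follows from the value at 1, where the cocycle identity
   forces 0. *)
exists (fun x => u x - E x); split=> [x y|a]; first by rewrite defect.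
have u1 : u 1%g - E 1%g = 0.
  have := defect 1%g 1%g; rewrite mulg1 projg1 hol1 mul1mx.
  by move/(canRL (addrK _)); rewrite subrr.
by rewrite -[i_ a]mulg1 u_iota E_iota -addrA u1 addr0.
Qed.

Lemma presented_card (D : cryst_data) : presented_by c D -> dcard D = #|G|.
Proof.
case=> _ [num [_ [num_bij _ _ _ _]]].
by rewrite -(bij_eq_card num_bij) card_ord.
Qed.

(** From left to right, a cocycle is evaluated on the chosen section [s].  From
    right to left, a solution [t] prescribes a function on
    [Gamma = Lambda s(G)] by [i_ a * s i |-> d a + t i]; it satisfies the cocycle
    identity modulo [#|G|], and [scaling_cocycle_mod] corrects it. *)
Lemma presented_scaling (D : cryst_data) d :
    presented_by c D ->
  (exists u, scaling_cocycle d u) <->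
  (exists t, @mod_solution D d t).
Proof.
move=> presD; have := presented_card presD; case: D presD => n r' mul rep coc.
case=> /= er [num [s [num_bij s_num mul_num rep_hol cocP]]] cardG.
subst r'; rewrite /mod_solution /=.
have repE i : rep i = L (s i) by rewrite s_num -rep_hol castmx_id.
have sM i j : (s i * s j)%g = (i_ (coc i j) * s (mul i j))%g.
  by have := cocP i j; rewrite castmx_id => ->; rewrite mulgKV.
split=> [[u [uM u_iota]] | [t sol]].
  exists (fun i => u (s i)) => i j k.
  have -> : u (s i) + rep i *m u (s j) = coc i j *+ d + u (s (mul i j)).
    by rewrite repE -uM sM uM u_iota proj_iota hol1 mul1mx.
  by rewrite addrK subrr mxE dvdz0.
have [idx numK idxK] := num_bij.
have exa x : exists a, x == (i_ a * s (idx (p x)))%g.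
  have [|a ->] := @same_proj x (s (idx (p x))); first by rewrite s_num idxK.
  by exists a; rewrite projM proj_iota mul1g s_num numK.
pose a x := xchoose (exa x).
have aE x : x = (i_ (a x) * s (idx (p x)))%g := eqP (xchooseP (exa x)).
have a_uniq x b i : x = (i_ b * s i)%g -> a x = b /\ idx (p x) = i.
  move=> def_x; have pxi : idx (p x) = i.
    by rewrite def_x projM proj_iota mul1g s_num numK.
  split=> //; apply: (iota_inj (c := c)); apply: (mulIg (s i)).
  by rewrite -def_x -pxi -aE.
pose u x := a x *+ d + t (idx (p x)).
have uE b i : u (i_ b * s i)%g = b *+ d + t i.
  by rewrite /u; have [-> ->] := a_uniq _ _ _ (erefl (i_ b * s i)%g).
apply: (@scaling_cocycle_mod d u) => [b x | x y].
  by rewrite [in LHS](aE x) mulgA -Defs.iotaD uE mulrnDl /u addrA.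
rewrite (aE x) (aE y).
move: (a x) (a y) (idx (p x)) (idx (p y)) => {x y} b b' i j.
have -> : (i_ b * s i * (i_ b' * s j) =
           i_ (b + rep i *m b' + coc i j) * s (mul i j))%g.
  rewrite !Defs.iotaD repE -!mulgA -sM !mulgA.
  by rewrite -[(_ * i_ b')%g]mulgA iota_conj !mulgA.
rewrite !uE projM proj_iota mul1g -repE.
pose M := t i + rep i *m t j - t (mul i j) - coc i j *+ d.
exists (\col_k (M k 0%R %/ n%:Z)%Z).
have <- : M = (\col_k (M k 0%R %/ n%:Z)%Z) *+ #|G|.
  apply/colP => k; rewrite mulmxnE -cardG -mulr_natr natz [X in _ = X * _]mxE.
  by rewrite divzK //; apply: sol.
rewrite /M mulmxDr mulmxMn; col_abel.
Qed.

End Crystal.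

(** * Affine realizations in characteristic zero *)

Section CharZero.
Variable K : fieldType.
Hypothesis charK : [pchar K] =i pred0.

Lemma natr_neq0 n : (0 < n)%N -> n%:R != 0 :> K.
Proof. by rewrite lt0n ((pcharf0P K).1 charK). Qed.

Lemma intr_inj0 : injective (intr : int -> K).
Proof.
move=> a b eqab; apply/eqP; rewrite -subr_eq0 -absz_eq0 -((pcharf0P K).1 charK).
have: (a - b)%:~R = 0 :> K by rewrite rmorphB /= eqab subrr.
by case: (a - b) => m /=; rewrite ?NegzE ?rmorphN /= => /eqP; rewrite ?oppr_eq0.
Qed.

(** In characteristic 0, [ratr] is the embedding of the rationals in [K]; this and
    the next lemma are the instances of its injectivity and multiplicativity on
    which the comparison of [K] with the rationals rests. *)
Lemma ratr_intr_eq (q : rat) (z : int) : ratr q = z%:~R :> K -> q = z%:~R.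
Proof.
have den_gt0 : (0 < `|denq q|)%N by rewrite absz_gt0 denq_neq0.
have den_neq0 : (denq q)%:~R != 0 :> K.
  by rewrite -(gez0_abs (denq_ge0 q)) natr_neq0.
move/(canRL (divfK den_neq0)); rewrite -rmorphM => /intr_inj0 num_q.
by rewrite -[q]divq_num_den num_q rmorphM /= mulfK // intr_eq0 denq_neq0.
Qed.

Lemma ratr_divn (z : int) d :
  (0 < d)%N -> ratr (d%:R^-1 * z%:~R) = d%:R^-1 * z%:~R :> K.
Proof.
move=> d_gt0; set q := _ * _ : rat.
have den_gt0 : (0 < `|denq q|)%N by rewrite absz_gt0 denq_neq0.
have den_neq0 : (denq q)%:~R != 0 :> K.
  by rewrite -(gez0_abs (denq_ge0 q)) natr_neq0.
have dQ : d%:R != 0 :> rat by rewrite pnatr_eq0 -lt0n.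
have : (numq q * d%:Z)%:~R = (z * denq q)%:~R :> rat.
  rewrite !rmorphM /= numqE /q; field; exact: dQ.
move/intr_inj/(congr1 (intr : int -> K)).
rewrite !rmorphM /= => eqK; have dK := natr_neq0 d_gt0.
rewrite /ratr; apply: (mulIf den_neq0); rewrite divfK //.
by apply: (mulIf dK); rewrite eqK mulrC; field.
Qed.
End CharZero.

Lemma pchar_rat : [pchar rat] =i pred0. Proof. exact: pchar_num. Qed.

Lemma map_mx_intr_inj m n :
  injective (map_mx intr : 'M[int]_(m, n) -> 'M[rat]_(m, n)).
Proof.
move=> A B /matrixP eqAB; apply/matrixP => i j.
by have := eqAB i j; rewrite !mxE => /intr_inj.
Qed.

Section Realizations.
Variables (r : nat) (Gamma : groupType) (G : finGroupType).
Variable c : crystal r Gamma G.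

Local Notation p := (proj c).
Local Notation i_ := (Defs.iota c).
Local Notation L x := (hol c (proj c x)).

Section OverField.
Variables (K : fieldType) (d : nat).

Lemma hol_unit x : map_mx (intr : int -> K) (L x) \in unitmx.
Proof.
have [] // := @mulmx1_unit K r (map_mx intr (L x)) (map_mx intr (L x^-1%g)).
by rewrite -map_mxM -holM -projM mulgV projg1 hol1 map_mx1.
Qed.

Definition scaled_realization (u : Gamma -> 'cV[int]_r) (x : Gamma) : aff K r :=
  Aff (d%:R^-1 *: map_mx intr (u x)) (hol_unit x).

Lemma scaled_realizationP u :
    [pchar K] =i pred0 -> (0 < d)%N -> scaling_cocycle c d u ->
  affine_realization c (scaled_realization u).
Proof.
move=> charK d_gt0 [uM u_iota]; split=> [x y v | a v | x]; rewrite ?/aff_app /=.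
- rewrite uM projM holM map_mxM map_mxD map_mxM /= mulmxDr mulmxA.
  by rewrite scalerDr -scalemxAr -!addrA [in RHS](addrC (_ *: _)).
- rewrite proj_iota hol1 map_mx1 mul1mx u_iota; congr (_ + _).
  rewrite raddfMn -scaler_nat scalerA mulVf ?scale1r //.
  exact: (natr_neq0 charK).
by eexists => v; rewrite /aff_app /=.
Qed.

End OverField.

Section Unique.
Variables (K : fieldType).
Hypothesis charK : [pchar K] =i pred0.

Lemma realization_linear (rho : Gamma -> aff K r) x v :
  affine_realization c rho -> rho x v = map_mx intr (L x) *m v + rho x 0.
Proof. by case=> _ _ /(_ x) [u uE]; rewrite !uE mulmx0 add0r. Qed.

(** The difference [D] of the translation parts is a cocycle that vanishes on
    [Lambda]; summing [D (x y) = D x + L(x) D y] over the cosets of [y] gives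
    [#|G| D x = S - L(x) S], where [S] is the sum of the values of [D].  The
    conjugating translation is thus [S / #|G|]. *)
Lemma realizations_same_class (rho1 rho2 : Gamma -> aff K r) :
    affine_realization c rho1 -> affine_realization c rho2 ->
  same_class rho1 rho2.
Proof.
move=> aff1 aff2; pose D x := rho2 x 0 - rho1 x 0.
have [hom1 iota1 _] := aff1; have [hom2 iota2 _] := aff2.
have DM x y : D (x * y)%g = D x + map_mx intr (L x) *m D y.
  rewrite /D hom1 hom2 (realization_linear x _ aff1).
  by rewrite (realization_linear x _ aff2) mulmxBr opprD addrACA addrC.
have D_iota a x : D (i_ a * x)%g = D x.
  by rewrite DM proj_iota hol1 map_mx1 mul1mx /D iota1 iota2 subrr add0r.
have nK : #|G|%:R != 0 :> K := natr_neq0 charK (card_holonomy_gt0 G).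
pose S := \sum_(g : G) D (sec c g).
have DS x : #|G|%:R *: D x = S - map_mx intr (L x) *m S.
  apply/eqP; rewrite eq_sym subr_eq; apply/eqP.
  rewrite {1}/S -(sum_sec_shift x D_iota) scaler_nat -sumr_const.
  by rewrite /S mulmx_sumr -big_split /=; apply: eq_bigr => g _.
exists (#|G|%:R^-1 *: S) => x v.
rewrite (realization_linear x _ aff1) (realization_linear x _ aff2).
have -> : rho2 x 0 = rho1 x 0 + D x by rewrite addrC subrK.
have -> : D x = #|G|%:R^-1 *: S - map_mx intr (L x) *m (#|G|%:R^-1 *: S).
  by rewrite -scalemxAr -scalerBr -DS scalerA mulVf ?scale1r.
rewrite mulmxBr; move: (rho1 x 0) (_ *: S) (_ *m (_ *: _)) (_ *m v) => b f e a.
by rewrite -!addrA; congr (_ + _); rewrite [in LHS]addrA [LHS]addrC.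
Qed.

(** If the class is obtained via [(1/d) Lambda], the rational transformations
    [rho' x] have linear part [L(x)], because their linear parts agree with [L(x)]
    in [K], and translation part in [(1/d) Lambda], because it is the image of 0;
    multiplying these by [d] gives the cocycle.  Conversely a cocycle defines a
    realization via [(1/d) Lambda] over every field, which by uniqueness lies in
    the given class. *)
Lemma class_obtained_viaP (rho : Gamma -> aff K r) d :
    (0 < d)%N -> affine_realization c rho ->
  class_obtained_via d rho <-> exists u, scaling_cocycle c d u.
Proof.
move=> d_gt0 rho_real; have dQ : d%:R != 0 :> rat by rewrite pnatr_eq0 -lt0n.
split=> [[rho1 [[w rho1E] [rho' [hom' lat' rho1']]]] | [u u_ext]]; last first.
  exists (@scaled_realization K d u); split.
    apply: realizations_same_class rho_real _.
    exact: scaled_realizationP charK d_gt0 u_ext.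
  have [hom' _ _] := scaled_realizationP pchar_rat d_gt0 u_ext.
  exists (@scaled_realization rat d u); split=> //.
    have stable x v :
        inv_lattice d v -> inv_lattice d (scaled_realization rat d u x v).
      case=> a ->; exists (L x *m a + u x).
      by rewrite /aff_app /= map_mxD map_mxM scalerDr scalemxAr.
    move=> x v; split=> [|]; last exact: stable.
    move/(stable x^-1%g); rewrite -hom' mulVg.
    suff -> : scaled_realization rat d u 1%g v = v by [].
    have [_ /(_ 0 v) + _] := scaled_realizationP pchar_rat d_gt0 u_ext.
    by rewrite iota0 map_mx0 addr0.
  move=> x v; rewrite /aff_app /=; congr (_ *m _ + _).
    by apply/matrixP => i j; rewrite !mxE ratr_int.
  by apply/colP => i; rewrite !mxE (ratr_divn charK).
have [hom iota_rho _] := rho_real.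
have rho1_lin x v : rho1 x v = map_mx intr (L x) *m v + rho1 x 0.
  rewrite !rho1E [in LHS](realization_linear x _ rho_real).
  rewrite [in RHS](realization_linear x _ rho_real) mulmxBr sub0r mulmxN.
  by rewrite !addrA.
have atr1 x : rho1 x 0 = map_mx ratr (atr (rho' x)).
  by rewrite rho1' mulmx0 add0r.
have lin' x : alin (rho' x) = map_mx intr (L x).
  have : map_mx ratr (alin (rho' x)) = map_mx intr (L x) :> 'M[K]_r.
    apply: mulmx_ext => v; apply: (addIr (rho1 x 0)).
    by rewrite -rho1_lin atr1 -rho1'.
  move/matrixP => eq_lin; apply/matrixP => i j; have := eq_lin i j.
  by rewrite !mxE => /(ratr_intr_eq charK).
have exu x : exists a : 'cV[int]_r, atr (rho' x) == d%:R^-1 *: map_mx intr a.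
  have [a def_a] : inv_lattice d (rho' x 0).
    by apply/lat'; exists 0; rewrite map_mx0 scaler0.
  by exists a; rewrite -def_a /aff_app mulmx0 add0r.
pose u x := xchoose (exu x).
have uE x : map_mx intr (u x) = d%:R *: atr (rho' x).
  by rewrite (eqP (xchooseP (exu x))) scalerA mulfV ?scale1r.
exists u; split=> [x y | a]; apply: map_mx_intr_inj.
- rewrite map_mxD map_mxM /= !uE -lin' -scalemxAr -scalerDr; congr (_ *: _).
  have := hom' x y 0; rewrite /aff_app mulmx0 add0r mulmx0 add0r => ->.
  by rewrite addrC.
rewrite uE raddfMn /= -scaler_nat; congr (_ *: _).
have : map_mx ratr (atr (rho' (i_ a))) = map_mx intr a :> 'cV[K]_r.
  by rewrite -atr1 rho1E iota_rho sub0r addrAC addNr add0r.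
move/matrixP => eq_atr; apply/matrixP => i j; have := eq_atr i j.
by rewrite !mxE => /(ratr_intr_eq charK).
Qed.
End Unique.
End Realizations.

(** * Closure properties of recursive functions *)

Section Computability.
Local Open Scope nat_scope.

(** Functions of [n] arguments are written as functions of an infinite
    environment that vanishes from index [n] on.  Variables are then [e 0], [e 1],
    and so on, and binding one more variable is the shift [fun i => e i.+1], which
    disappears by beta-reduction; no tuple has to be manipulated below. *)
Definition rec_in (n : nat) (F : (nat -> nat) -> nat) : Prop :=
  @recursive n (fun t => F (nth 0 t)).

Lemma rec_in_ext n F F' : (forall e, F e = F' e) -> rec_in n F -> rec_in n F'.
Proof. by move=> /functional_extensionality ->. Qed.

Lemma recursive_ext n (f f' : n.-tuple nat -> nat) :
  f =1 f' -> recursive f -> recursive f'.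
Proof. by move=> /functional_extensionality ->. Qed.

Lemma rec_in_zero n : rec_in n (fun=> 0).
Proof. exact: rec_zero. Qed.

Lemma rec_in_var n i : rec_in n (fun e => e i).
Proof.
have [lt_in | le_ni] := ltnP i n; last first.
  by apply: recursive_ext (rec_zero n) => t; rewrite nth_default ?size_tuple.
by apply: recursive_ext (rec_proj (Ordinal lt_in)) => t; apply: tnth_nth.
Qed.

(** The last hypothesis says that the environment built from [g] again vanishes
    from index [m] on. *)
Lemma rec_in_comp m n F (g : nat -> (nat -> nat) -> nat) :
    rec_in m F -> (forall i, rec_in n (g i)) ->
    (forall i (t : n.-tuple nat), m <= i -> g i (nth 0 t) = 0) ->
  rec_in n (fun e => F (g^~ e)).
Proof.
move=> recF recg g0.
apply: recursive_ext (rec_comp recF (fun i : 'I_m => recg i)) => t.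
congr F; apply: functional_extensionality => i.
have [lt_im | le_mi] := ltnP i m; last by rewrite g0 ?nth_default ?size_tuple.
by rewrite -[i in LHS]/(nat_of_ord (Ordinal lt_im)) -tnth_nth tnth_mktuple.
Qed.

Lemma rec_in_subst n B F :
    rec_in n B -> rec_in n.+1 (fun e => F (e 0) (fun i => e i.+1)) ->
  rec_in n (fun e => F (B e) e).
Proof.
move=> recB recF.
apply: (rec_in_comp (g := fun i e => if i is j.+1 then e j else B e) recF).
  by case=> [|i] //; apply: rec_in_var.
by case=> // i t le_ni; rewrite nth_default ?size_tuple.
Qed.

(** Needed for loops on an accumulator: the body does not see it, and the
    variable [e 1] that holds it must be skipped. *)
Lemma rec_in_skip n (F : nat -> (nat -> nat) -> nat) :
    rec_in n.+1 (fun e => F (e 0) (fun i => e i.+1)) ->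
  rec_in n.+2 (fun e => F (e 0) (fun i => e i.+2)).
Proof.
pose g i e : nat := if i is j.+1 then e j.+2 else e 0.
move=> recF; apply: (rec_in_comp (g := g) recF).
  by case=> [|i]; apply: rec_in_var.
by case=> // i t le_ni; rewrite /g nth_default ?size_tuple.
Qed.

Lemma rec_in_app1 n h F :
  rec_in 1 (fun e => h (e 0)) -> rec_in n F -> rec_in n (fun e => h (F e)).
Proof.
move=> rech recF.
apply: (rec_in_comp (g := fun i e => if i is 0 then F e else 0) rech); case=> //.
by move=> i; apply: rec_in_zero.
Qed.

Lemma rec_in_app2 n h F G :
    rec_in 2 (fun e => h (e 0) (e 1)) -> rec_in n F -> rec_in n G ->
  rec_in n (fun e => h (F e) (G e)).
Proof.
move=> rech recF recG.
pose g i e := match i with 0 => F e | 1 => G e | _ => 0 end.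
apply: (rec_in_comp (g := g) rech); case=> [|[|i]] //.
exact: rec_in_zero.
Qed.

Lemma rec_in_succ n F : rec_in n F -> rec_in n (fun e => (F e).+1).
Proof.
apply: rec_in_app1; apply: recursive_ext rec_succ => t.
by rewrite /thead (tnth_nth 0).
Qed.

Lemma rec_in_const n k : rec_in n (fun=> k).
Proof. by elim: k => [|k IHk]; [apply: rec_in_zero | apply: rec_in_succ]. Qed.

Lemma rec_in_iteri n B a F :
    rec_in n B -> rec_in n a ->
    rec_in n.+2 (fun e => F (e 0) (e 1) (fun i => e i.+2)) ->
  rec_in n (fun e => iteri (B e) (fun k x => F k x e) (a e)).
Proof.
move=> recB reca recF.
apply: (rec_in_subst (F := fun b e => iteri b (fun k x => F k x e) (a e)) recB).
exact: (rec_prim (f := fun t => a (nth 0 t)) reca recF).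
Qed.

Lemma rec_in_iter n B a F :
    rec_in n B -> rec_in n a ->
    rec_in n.+2 (fun e => F (e 1) (fun i => e i.+2)) ->
  rec_in n (fun e => iter (B e) (fun x => F x e) (a e)).
Proof.
move=> recB reca recF.
apply: rec_in_ext (rec_in_iteri (F := fun _ x e => F x e) recB reca recF) => e.
by elim: (B e) => //= k ->.
Qed.

Lemma rec_in_add n F G :
  rec_in n F -> rec_in n G -> rec_in n (fun e => F e + G e).
Proof.
apply: rec_in_app2; apply: rec_in_ext (fun e => iter_succn (e 0) (e 1)) _.
apply: rec_in_iter; do ?apply: rec_in_succ; exact: rec_in_var.
Qed.

Lemma rec_in_mul n F G :
  rec_in n F -> rec_in n G -> rec_in n (fun e => F e * G e).
Proof.
apply: rec_in_app2; apply: rec_in_ext (fun e => iter_addn_0 (e 0) (e 1)) _.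
apply: (rec_in_iter (F := fun x e => e 0 + x)).
- exact: rec_in_var.
- exact: rec_in_zero.
by apply: rec_in_add; apply: rec_in_var.
Qed.

Lemma rec_in_exp n F G :
  rec_in n F -> rec_in n G -> rec_in n (fun e => F e ^ G e).
Proof.
apply: rec_in_app2.
apply: (@rec_in_ext 2 (fun e => iter (e 1) (fun x => e 0 * x) 1)) => [e|].
  exact: iter_muln_1.
apply: (rec_in_iter (F := fun x e => e 0 * x)).
- exact: rec_in_var.
- exact: rec_in_const.
by apply: rec_in_mul; apply: rec_in_var.
Qed.

Lemma rec_in_pred n F : rec_in n F -> rec_in n (fun e => (F e).-1).
Proof.
apply: rec_in_app1.
apply: (@rec_in_ext 1 (fun e => iteri (e 0) (fun k _ => k) 0)) => [e|].
  by case: (e 0).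
apply: (rec_in_iteri (F := fun k _ _ => k)); first exact: rec_in_var.
  exact: rec_in_zero.
exact: rec_in_var.
Qed.

Lemma rec_in_sub n F G :
  rec_in n F -> rec_in n G -> rec_in n (fun e => F e - G e).
Proof.
apply: rec_in_app2.
apply: (@rec_in_ext 2 (fun e => iter (e 1) predn (e 0))) => [e|].
  exact: iter_predn.
apply: (rec_in_iter (F := fun x _ => x.-1)); do ?apply: rec_in_pred.
all: exact: rec_in_var.
Qed.

Lemma rec_in_eq0 n F : rec_in n F -> rec_in n (fun e => F e == 0).
Proof.
move=> recF; apply: rec_in_ext (rec_in_sub (rec_in_const n 1) recF) => e.
by case: (F e).
Qed.

Lemma rec_in_leq n F G :
  rec_in n F -> rec_in n G -> rec_in n (fun e => F e <= G e).
Proof. by move=> recF recG; apply: rec_in_eq0; apply: rec_in_sub. Qed.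

Lemma rec_in_neg n (P : (nat -> nat) -> bool) :
  rec_in n P -> rec_in n (fun e => ~~ P e).
Proof. by move/rec_in_eq0; apply: rec_in_ext => e; case: (P e). Qed.

Lemma rec_in_sum n B F :
    rec_in n B -> rec_in n.+1 (fun e => F (e 0) (fun i => e i.+1)) ->
  rec_in n (fun e => \sum_(0 <= k < B e) F k e).
Proof.
move=> recB recF.
apply: (@rec_in_ext n (fun e => iteri (B e) (fun k x => x + F k e) 0)) => [e|].
  by elim: (B e) => [|b /= ->]; [rewrite big_geq | rewrite big_nat_recr].
apply: (rec_in_iteri (F := fun k x e => x + F k e) recB (rec_in_zero n)).
apply: rec_in_add; first exact: rec_in_var.
exact: rec_in_skip.
Qed.

Lemma rec_in_has n B (P : nat -> (nat -> nat) -> bool) :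
    rec_in n B -> rec_in n.+1 (fun e => P (e 0) (fun i => e i.+1)) ->
  rec_in n (fun e => has (P^~ e) (iota 0 (B e))).
Proof.
move=> recB recP.
apply: rec_in_ext (rec_in_leq (rec_in_const n 1)
  (rec_in_sum (F := fun k e => P k e) recB recP)) => e.
by rewrite /index_iota subn0 -big_mkcond sum1_count has_count.
Qed.

Lemma rec_in_all n B (P : nat -> (nat -> nat) -> bool) :
    rec_in n B -> rec_in n.+1 (fun e => P (e 0) (fun i => e i.+1)) ->
  rec_in n (fun e => all (P^~ e) (iota 0 (B e))).
Proof.
move=> recB /rec_in_neg recP.
apply: rec_in_ext
  (rec_in_neg (rec_in_has (P := fun k e => ~~ P k e) recB recP)) => e.
by rewrite has_predC negbK.
Qed.

Lemma rec_in_find n B (P : nat -> (nat -> nat) -> bool) :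
    rec_in n B -> rec_in n.+1 (fun e => P (e 0) (fun i => e i.+1)) ->
  rec_in n (fun e => find (P^~ e) (iota 0 (B e))).
Proof.
move=> recB recP.
(* The first index satisfying [P] is the number of [k] such that no index up to
   [k] satisfies [P]. *)
apply: (@rec_in_ext n
  (fun e => \sum_(0 <= k < B e) ~~ has (P^~ e) (iota 0 k.+1))).
  move=> e; elim: (B e) => [|b IHb]; first by rewrite big_geq.
  rewrite big_nat_recr // IHb -addn1 iotaD find_cat has_cat size_iota add0n.
  case: ifP => hasP /=; first by rewrite addn0.
  by rewrite hasNfind ?hasP // size_iota; case: (P b e).
apply: (rec_in_sum (F := fun k e => ~~ has (P^~ e) (iota 0 k.+1)) recB).
apply: rec_in_neg.
apply: (rec_in_has (B := fun e => (e 0).+1)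
  (P := fun k e => P k (fun i => e i.+1))).
  by apply: rec_in_succ; apply: rec_in_var.
exact: (rec_in_skip (F := P)).
Qed.

Lemma rec_in_if n (P : (nat -> nat) -> bool) F G :
    rec_in n P -> rec_in n F -> rec_in n G ->
  rec_in n (fun e => if P e then F e else G e).
Proof.
move=> recP recF recG.
apply: rec_in_ext (rec_in_add (rec_in_mul recP recF)
  (rec_in_mul (rec_in_neg recP) recG)) => e.
by case: (P e); rewrite !mul1n !mul0n ?addn0.
Qed.

Lemma rec_in_eq n F G :
  rec_in n F -> rec_in n G -> rec_in n (fun e => F e == G e).
Proof.
move=> recF recG.
apply: rec_in_ext (rec_in_mul (rec_in_leq recF recG) (rec_in_leq recG recF)) => e.
by rewrite mulnb -eqn_leq.
Qed.

(** The factor [0 < d] is there because [m %/ 0 = 0], whereas the sum would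
    be [m]. *)
Lemma divn_sum m d : m %/ d = (0 < d) * \sum_(0 <= k < m) (k.+1 * d <= m).
Proof.
case: d => [|d]; first by rewrite divn0.
rewrite mul1n (big_cat_nat _ (leq_div m d.+1)) //=.
transitivity (\sum_(0 <= k < m %/ d.+1) 1 + 0).
  by rewrite sum_nat_const_nat subn0 muln1 addn0.
congr (_ + _).
  by apply: eq_big_nat => k /andP[_ lt_km]; rewrite -leq_divRL // lt_km.
rewrite big_nat_cond big1 // => k; rewrite andbT => /andP[le_mk _].
by rewrite -leq_divRL // ltnNge le_mk.
Qed.

Lemma rec_in_div n F G :
  rec_in n F -> rec_in n G -> rec_in n (fun e => F e %/ G e).
Proof.
apply: rec_in_app2; apply: rec_in_ext (fun e => esym (divn_sum (e 0) (e 1))) _.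
apply: rec_in_mul.
  by apply: rec_in_leq; [apply: rec_in_const | apply: rec_in_var].
apply: (rec_in_sum (F := fun k e => k.+1 * e 1 <= e 0)); first exact: rec_in_var.
apply: rec_in_leq; last exact: rec_in_var.
by apply: rec_in_mul; [apply: rec_in_succ|]; apply: rec_in_var.
Qed.

Lemma rec_in_mod n F G :
  rec_in n F -> rec_in n G -> rec_in n (fun e => F e %% G e).
Proof.
move=> recF recG.
apply: rec_in_ext (rec_in_sub recF (rec_in_mul (rec_in_div recF recG) recG)) => e.
by rewrite [X in X - _](divn_eq _ (G e)) addKn.
Qed.

Lemma rec_in_dvdn n F G :
  rec_in n F -> rec_in n G -> rec_in n (fun e => F e %| G e).
Proof. by move=> recF recG; apply: rec_in_eq0; apply: rec_in_mod. Qed.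

Lemma rec_in_logn2 n F : rec_in n F -> rec_in n (fun e => logn 2 (F e)).
Proof.
apply: rec_in_app1.
apply: (@rec_in_ext 1
  (fun e => \sum_(0 <= k < (e 0).-1) (2 ^ k.+1 %| e 0))) => [e|].
  by rewrite logn_count_dvd // big_add1.
apply: (rec_in_sum (F := fun k e => 2 ^ k.+1 %| e 0)).
  by apply: rec_in_pred; apply: rec_in_var.
apply: rec_in_dvdn; last exact: rec_in_var.
apply: rec_in_exp; first exact: rec_in_const.
by apply: rec_in_succ; apply: rec_in_var.
Qed.

End Computability.

(** * The algorithm and its correctness *)

Section Program.
Local Open Scope nat_scope.

(** [CodeSeq.code (v :: s)] is [2 ^ v * (2 * code s + 1)]: the head is the 2-adic
    valuation, and dividing by one more power of 2 leaves the code of the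
    tail. *)
Definition entry c i := logn 2 (iter i (fun x => x %/ 2 ^ (logn 2 x).+1) c).

Lemma rec_in_entry n F G :
  rec_in n F -> rec_in n G -> rec_in n (fun e => entry (F e) (G e)).
Proof.
apply: rec_in_app2; apply: rec_in_logn2.
apply: (rec_in_iter (F := fun x e => x %/ 2 ^ (logn 2 x).+1)).
- exact: rec_in_var.
- exact: rec_in_var.
apply: rec_in_div; first exact: rec_in_var.
apply: rec_in_exp; first exact: rec_in_const.
by apply: rec_in_succ; apply: rec_in_logn2; apply: rec_in_var.
Qed.

(** A natural number congruent modulo [n] to the integer coded by [z]: the odd
    number [2 m + 1] codes [-(m + 1)], which is congruent to
    [(n - 1) (m + 1)]. *)
Definition residue n z := if 2 %| z then z %/ 2 else n.-1 * (z %/ 2).+1.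

Lemma rec_in_residue n F G :
  rec_in n F -> rec_in n G -> rec_in n (fun e => residue (F e) (G e)).
Proof.
move=> recF recG; have rec2 := rec_in_const n 2; apply: rec_in_if.
- exact: rec_in_dvdn.
- exact: rec_in_div.
apply: rec_in_mul; first exact: rec_in_pred.
by apply: rec_in_succ; apply: rec_in_div.
Qed.

(** A cochain modulo [n] with [n * r] coordinates is encoded by the number [T]
    below [n ^ (n * r)] of which it is the list of digits in base [n]. *)
Definition digit n T m := T %/ n ^ m %% n.

(** The positions of the multiplication table, of the matrices and of the
    cocycle in the list that is coded, each block being read row by row. *)
Definition code_card c := entry c 0.
Definition code_rank c := entry c 1.
Definition code_mul c i j := entry c (2 + (i * code_card c + j)).
Definition code_rep c i k l := entry c
  (2 + code_card c * code_card c
   + (i * (code_rank c * code_rank c) + (k * code_rank c + l))).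
Definition code_coc c i j k := entry c
  (2 + code_card c * code_card c
   + code_card c * (code_rank c * code_rank c)
   + ((i * code_card c + j) * code_rank c + k)).

(** The search for a solution modulo [n] of the system of [mod_solution], over
    the numbers [T] that encode its candidates, with one test for each pair
    [i, j] and each coordinate [k]. *)
Definition kills_class c d :=
  has (fun T => all (fun i => all (fun j => all (fun k =>
    digit (code_card c) T (i * code_rank c + k)
    + \sum_(0 <= l < code_rank c) residue (code_card c) (code_rep c i k l)
        * digit (code_card c) T (j * code_rank c + l)
    == digit (code_card c) T (code_mul c i j * code_rank c + k)
       + d * residue (code_card c) (code_coc c i j k)
    %[mod code_card c])
    (iota 0 (code_rank c))) (iota 0 (code_card c))) (iota 0 (code_card c)))
  (iota 0 (code_card c ^ (code_card c * code_rank c))).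

Definition min_denominator c :=
  (find (fun d => kills_class c d.+1) (iota 0 (code_card c))).+1.

(** Syntax-directed application of the closure lemmas; numerals are treated as
    iterated successors of 0. *)
Ltac rec_in_tac := cbv beta; repeat lazymatch goal with
  | |- rec_in _ (fun e => nat_of_bool (has (fun k => @?P k e) (iota 0 (@?B e)))) =>
      refine (@rec_in_has _ B P _ _); cbv beta
  | |- rec_in _ (fun e => nat_of_bool (all (fun k => @?P k e) (iota 0 (@?B e)))) =>
      refine (@rec_in_all _ B P _ _); cbv beta
  | |- rec_in _ (fun e => find (fun k => @?P k e) (iota 0 (@?B e))) =>
      refine (@rec_in_find _ B P _ _); cbv beta
  | |- rec_in _ (fun e => \sum_(0 <= k < @?B e) @?F k e) =>
      refine (@rec_in_sum _ B F _ _); cbv beta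
  | |- rec_in _ (fun e => nat_of_bool (dvdn (@?F e) (@?G e))) => apply: rec_in_dvdn
  | |- rec_in _ (fun e => nat_of_bool ((@?F e) == (@?G e))) => apply: rec_in_eq
  | |- rec_in _ (fun e => residue (@?F e) (@?G e)) => apply: rec_in_residue
  | |- rec_in _ (fun e => addn (@?F e) (@?G e)) => apply: rec_in_add
  | |- rec_in _ (fun e => muln (@?F e) (@?G e)) => apply: rec_in_mul
  | |- rec_in _ (fun e => divn (@?F e) (@?G e)) => apply: rec_in_div
  | |- rec_in _ (fun e => modn (@?F e) (@?G e)) => apply: rec_in_mod
  | |- rec_in _ (fun e => expn (@?F e) (@?G e)) => apply: rec_in_exp
  | |- rec_in _ (fun e => entry (@?F e) (@?G e)) => apply: rec_in_entry
  | |- rec_in _ (fun e => predn (@?F e)) => apply: rec_in_pred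
  | |- rec_in _ (fun e => e ?i) => exact: rec_in_var
  | |- rec_in _ (fun e => S (@?F e)) => apply: rec_in_succ
  | |- rec_in _ (fun e => O) => exact: rec_in_const
  end.

Lemma computable_min_denominator : computable min_denominator.
Proof.
apply: (@recursive_ext 1 (fun t => min_denominator (nth 0 t 0))) => [t|].
  by rewrite /thead (tnth_nth 0).
rewrite -[recursive _]/(rec_in 1 (fun e => min_denominator (e 0))).
rewrite /min_denominator /kills_class /digit /code_mul /code_rep /code_coc.
rewrite /code_card /code_rank; rec_in_tac.
Qed.

Lemma entry_code s i : entry (CodeSeq.code s) i = nth 0 s i.
Proof.
have logn_cons v w : logn 2 (2 ^ v * w.*2.+1) = v.
  rewrite lognM ?expn_gt0 // pfactorK // logn_coprime ?addn0 //.
  by rewrite coprime2n /= odd_double.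
rewrite /entry; elim: i s => [|i IHi] [|v s]; rewrite ?iterSr //.
- exact: logn_cons.
- by rewrite [CodeSeq.code _]/= div0n (IHi [::]) nth_nil.
rewrite [CodeSeq.code _]/= logn_cons -[RHS]IHi expnSr; congr (logn 2 (iter i _ _)).
by rewrite divnMA mulKn ?expn_gt0 // divn2 /= uphalf_double.
Qed.

Lemma nth_flatten_const (T : Type) (x0 : T) m (ss : seq (seq T)) i j :
    all (fun s => size s == m) ss -> i < size ss -> j < m ->
  nth x0 (flatten ss) (i * m + j) = nth x0 (nth [::] ss i) j.
Proof.
elim: ss i => // s ss IHss [|i] /= /andP[/eqP size_s size_ss] lt_i lt_jm.
  by rewrite nth_cat size_s lt_jm.
rewrite nth_cat size_s mulSn -addnA ltnNge leq_addr /= addKn.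
exact: IHss.
Qed.

Lemma size_flatten_const (T : Type) m (ss : seq (seq T)) :
  all (fun s => size s == m) ss -> size (flatten ss) = size ss * m.
Proof.
elim: ss => //= s ss IHss /andP[/eqP size_s /IHss size_ss].
by rewrite size_cat size_s size_ss.
Qed.

Lemma nth_allpairs_ord (T : Type) (x0 : T) m n (f : 'I_m -> 'I_n -> T)
    (i : 'I_m) (j : 'I_n) :
  nth x0 [seq f i j | i <- enum 'I_m, j <- enum 'I_n] (i * n + j) = f i j.
Proof.
rewrite nth_flatten_const ?size_map -?enumT ?size_enum_ord ?ltn_ord //.
  rewrite (nth_map i) ?size_enum_ord // (nth_map j) ?size_enum_ord //.
  by rewrite !nth_ord_enum.
by rewrite all_map; apply/allP => k _ /=; rewrite size_map size_enum_ord.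
Qed.

Lemma ltn_pair m n i j : i < m -> j < n -> i * n + j < m * n.
Proof.
move=> lt_im lt_jn; apply: (@leq_trans (i.+1 * n)).
  by rewrite mulSn addnC ltn_add2r.
by rewrite leq_mul2r lt_im orbT.
Qed.

Section Data.
Variable D : cryst_data.
Let n := dcard D.
Let r := drank D.
Let c := code_data D.

Let mul_part := [seq nat_of_ord (@dmul D i j) | i <- enum 'I_n, j <- enum 'I_n].
Let rep_rows := [seq code_matrix (@drep D i) | i <- enum 'I_n].
Let coc_rows := [seq code_matrix (@dcoc D i j) | i <- enum 'I_n, j <- enum 'I_n].

Let cE : c = CodeSeq.code
  ([:: n; r] ++ (mul_part ++ (flatten rep_rows ++ flatten coc_rows))).
Proof. by []. Qed.

Lemma code_cardE : code_card c = n. Proof. exact: entry_code. Qed.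
Lemma code_rankE : code_rank c = r. Proof. exact: entry_code. Qed.

Let size_mul : size mul_part = n * n.
Proof. by rewrite size_allpairs !size_enum_ord. Qed.

Let rep_rowsE : all (fun s => size s == r * r) rep_rows.
Proof.
by rewrite all_map; apply/allP => i _ /=; rewrite size_allpairs !size_enum_ord.
Qed.

Let size_rep : size (flatten rep_rows) = n * (r * r).
Proof. by rewrite (size_flatten_const rep_rowsE) size_map size_enum_ord. Qed.

Let coc_rowsE : all (fun s => size s == r) coc_rows.
Proof.
apply/allP => s /allpairsP[ij [_ _ ->]].
by rewrite size_allpairs !size_enum_ord muln1.
Qed.

Lemma code_mulE (i j : 'I_n) : code_mul c i j = dmul i j.
Proof.
rewrite /code_mul code_cardE cE entry_code add2n /= nth_cat size_mul.
by rewrite ltn_pair ?ltn_ord // nth_allpairs_ord.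
Qed.

Lemma code_repE (i : 'I_n) (k l : 'I_r) :
  code_rep c i k l = code_int (drep i k l).
Proof.
rewrite /code_rep code_cardE code_rankE cE entry_code -addnA.
rewrite add2n /= nth_cat size_mul ltnNge leq_addr /= addKn.
rewrite nth_cat size_rep !ltn_pair ?ltn_ord //.
rewrite nth_flatten_const ?size_map -?enumT ?size_enum_ord ?ltn_pair ?ltn_ord //.
by rewrite (nth_map i) ?size_enum_ord // nth_ord_enum nth_allpairs_ord.
Qed.

Lemma code_cocE (i j : 'I_n) (k : 'I_r) :
  code_coc c i j k = code_int (dcoc i j k 0%R).
Proof.
rewrite /code_coc code_cardE code_rankE cE entry_code -!addnA.
rewrite add2n /= nth_cat size_mul ltnNge leq_addr /= addKn.
rewrite nth_cat size_rep ltnNge leq_addr /= addKn.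
rewrite nth_flatten_const ?size_allpairs -?enumT ?size_enum_ord ?ltn_pair //.
rewrite nth_allpairs_ord -[nat_of_ord k]addn0 -[nat_of_ord k]muln1.
exact: (nth_allpairs_ord 0 (fun i0 j0 => code_int (dcoc i j i0 j0)) k ord0).
Qed.

End Data.

Lemma exists_digits n (g : nat -> nat) M :
    (forall m, g m < n) ->
  exists2 T, T < n ^ M & forall m, m < M -> digit n T m = g m.
Proof.
move=> lt_gn; have n_gt0 : 0 < n := leq_ltn_trans (leq0n _) (lt_gn 0).
elim: M => [|M [T lt_T T_g]]; first by exists 0.
exists (g M * n ^ M + T).
  by rewrite expnS ltn_pair.
move=> m; rewrite ltnS leq_eqVlt /digit => /predU1P[->|lt_mM].
  by rewrite divnMDl ?expn_gt0 ?n_gt0 // divn_small // addn0 modn_small.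
have -> : n ^ M = n ^ (M - m.+1) * n * n ^ m.
  by rewrite -expnSr -expnD; congr (_ ^ _); lia.
rewrite -(T_g m lt_mM) /digit !mulnA divnMDl ?expn_gt0 ?n_gt0 //.
by rewrite modnMDl.
Qed.

Lemma residueE n z :
  0 < n -> (n%:Z %| ((residue n (code_int z))%:Z - z)%R)%Z.
Proof.
move=> n_gt0; rewrite /residue; case: z => m /=.
  by rewrite dvdn2 odd_double divn2 doubleK subrr dvdz0.
rewrite dvdn2 /= odd_double divn2 /= uphalf_double NegzE opprK.
by apply/dvdzP; exists m.+1%:Z; nia.
Qed.

Lemma modn_eq_dvdz n (a b : nat) :
  (a == b %[mod n]) = (n%:Z %| (a%:Z - b%:Z)%R)%Z.
Proof. by rewrite -eqz_mod_dvd !modz_nat. Qed.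

End Program.

(** Only the residues of [t] modulo [n] matter, so an arbitrary solution may be
    replaced by one with digits as coordinates, which some [T] encodes. *)
Lemma kills_classP (D : cryst_data) d :
    (0 < dcard D)%N ->
  reflect (exists t, @mod_solution D d t) (kills_class (code_data D) d).
Proof.
move=> n_gt0; set n := dcard D in n_gt0 *.
set r := drank D; set c := code_data D.
(* As every integer of the data is only replaced by a natural number congruent
   to it modulo [n], the test on the digits of [T] is the congruence itself. *)
have key T (t : 'I_n -> 'cV[int]_r) (i j : 'I_n) (k : 'I_r) :
    (forall (i : 'I_n) (k : 'I_r),
       (n%:Z %| ((digit n T (i * r + k))%:Z - t i k 0)%R)%Z) ->
  (digit n T (i * r + k)
    + \sum_(0 <= l < r) residue n (code_rep c i k l) * digit n T (j * r + l)
    == digit n T (code_mul c i j * r + k) + d * residue n (code_coc c i j k)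
    %[mod n])%N
  = (n%:Z %| (t i + drep i *m t j - t (dmul i j) - dcoc i j *+ d)%R k 0%R)%Z.
  move=> Tt; rewrite modn_eq_dvdz code_mulE code_cocE big_mkord.
  under eq_bigr => l _ do rewrite code_repE.
  set x := (t i + drep i *m t j - t (dmul i j) - dcoc i j *+ d) k 0.
  set y := (Posz _ - _)%R.
  have cong : (n%:Z %| y - x)%Z.
    have ->: y - x = ((digit n T (i * r + k))%:Z - t i k 0)
      - ((digit n T (dmul i j * r + k))%:Z - t (dmul i j) k 0)
      + \sum_l ((residue n (code_int (drep i k l)))%:Z * (digit n T (j * r + l))%:Z
          - drep i k l * t j l 0)
      - ((residue n (code_int (dcoc i j k 0)))%:Z - dcoc i j k 0) *+ d.
      rewrite /x /y !mxE mulmxnE sumrB !PoszD !PoszM.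
      rewrite -(big_morph Posz PoszD (erefl _)).
      by rewrite mulrnBl -[X in _ = _ - (X - _)]mulr_natl natz; ring.
    apply: rpredB; last by apply: rpredMn; apply: residueE.
    apply: rpredD; first by apply: rpredB; apply: Tt.
    apply: rpred_sum => l _.
    set p := (residue _ _)%:Z; set q := (digit _ _ _)%:Z.
    have -> : p * q - drep i k l * t j l 0
        = (p - drep i k l) * q + drep i k l * (q - t j l 0).
      by rewrite mulrBl mulrBr addrA subrK.
    apply: rpredD; first by apply: dvdz_mulr; apply: residueE.
    by apply: dvdz_mull; apply: Tt.
  by rewrite -(subrK x y) rpredDl.
apply: (iffP hasP) => [[T _ /allP solT] | [t sol]].
  pose t (i : 'I_n) : 'cV[int]_r := \col_k (digit n T (i * r + k))%:Z.
  have Tt (i : 'I_n) (k : 'I_r) :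
      (n%:Z %| ((digit n T (i * r + k))%:Z - t i k 0)%R)%Z.
    by rewrite mxE subrr dvdz0.
  exists t => i j k; rewrite -(key T) //.
  have ltn0 m p (u : 'I_p) : (p = m -> nat_of_ord u \in iota 0 m)%N.
    by move=> <-; rewrite mem_iota add0n ltn_ord.
  have /allP/(_ (nat_of_ord j))/(_ (ltn0 _ _ _ (esym (code_cardE D))))
    /allP/(_ (nat_of_ord k))/(_ (ltn0 _ _ _ (esym (code_rankE D)))) :=
    solT (nat_of_ord i) (ltn0 _ _ _ (esym (code_cardE D))).
  by rewrite code_cardE code_rankE.
pose g (m : nat) : nat :=
  if (insub (m %/ r)%N : option 'I_n, insub (m %% r)%N : option 'I_r)
    is (Some i, Some k) then `|(t i k 0%R %% n%:Z)%Z|%N else 0%N.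
have lt_g m : (g m < n)%N.
  rewrite /g; case: insub => [i|] //; case: insub => [k|] //.
  by rewrite -ltz_nat gez0_abs ?modz_ge0 ?ltz_pmod // -lt0n.
have [T lt_T digT] := exists_digits (n * r) lt_g.
have Tt (i : 'I_n) (k : 'I_r) :
    (n%:Z %| ((digit n T (i * r + k))%:Z - t i k 0)%R)%Z.
  have r_gt0 : (0 < r)%N := leq_ltn_trans (leq0n _) (ltn_ord k).
  rewrite digT ?ltn_pair // /g divnMDl // divn_small // addn0 valK.
  rewrite modnMDl modn_small // valK gez0_abs ?modz_ge0 -?lt0n //.
  by rewrite -eqz_mod_dvd modz_mod.
exists T; first by rewrite mem_iota code_cardE code_rankE.
apply/allP => i; rewrite mem_iota code_cardE => /= lt_i.
apply/allP => j; rewrite mem_iota => /= lt_j.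
apply/allP => k; rewrite mem_iota code_rankE => /= lt_k.
by rewrite (key T t (Ordinal lt_i) (Ordinal lt_j) (Ordinal lt_k)).
Qed.

Lemma min_denominator_kills (D : cryst_data) :
    (0 < dcard D)%N -> kills_class (code_data D) (dcard D) ->
  kills_class (code_data D) (min_denominator (code_data D)) /\
  forall d, (0 < d)%N -> kills_class (code_data D) d ->
    (min_denominator (code_data D) <= d)%N.
Proof.
set c := code_data D => n_gt0 killed_n; rewrite /min_denominator.
set P := fun d => kills_class c d.+1; set s := iota 0 (code_card c).
have hasP : has P s.
  apply/hasP; exists (dcard D).-1; last by rewrite /P prednK.
  by rewrite mem_iota code_cardE /= ltn_predL.
split.
  have := nth_find 0%N hasP; rewrite nth_iota //.
  by rewrite -[X in (_ < X)%N](size_iota 0) -has_find.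
case=> // d _ killed_d; rewrite ltnS leqNgt; apply/negP => lt_d.
have := before_find 0%N lt_d; rewrite nth_iota ?add0n.
  by rewrite /P killed_d.
by apply: leq_trans lt_d _; rewrite -[code_card c](size_iota 0); apply: find_size.
Qed.


(** * The minimal denominator *)

Lemma min_denominatorP (r : nat) (Gamma : groupType) (G : finGroupType)
    (c : crystal r Gamma G) (D : cryst_data)
    (d := min_denominator (code_data D)) :
    presented_by c D ->
  [/\ (0 < d)%N, exists u, scaling_cocycle c d u
    & forall d', (0 < d')%N -> (exists u, scaling_cocycle c d' u) ->
        (d <= d')%N].
Proof.
move=> presD; have n_gt0 : (0 < dcard D)%N.
  by rewrite (presented_card presD) card_holonomy_gt0.
have kills_classE d' :
    (exists u, scaling_cocycle c d' u) <-> kills_class (code_data D) d'.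
  by rewrite (presented_scaling d' presD); apply: rwP (kills_classP d' n_gt0).
have killed_n : kills_class (code_data D) (dcard D).
  (* For [d = #|G|] the right-hand side vanishes modulo [#|G|], so [t = 0]
     solves the system. *)
  apply/(kills_classP _ n_gt0); exists (fun=> 0) => i j k.
  rewrite mulmx0 addr0 subr0 sub0r mxE mulmxnE -mulr_natr natz.
  by rewrite -mulNr dvdz_mull.
have [killed_d min_d] := min_denominator_kills n_gt0 killed_n.
by split=> // [|d' d'_gt0 /kills_classE]; [apply/kills_classE | apply: min_d].
Qed.

Theorem theorem6 :
  (forall (r : nat) (Gamma : groupType) (G : finGroupType)
          (c : crystal r Gamma G) (K : fieldType),
     [pchar K] =i pred0 ->
     (exists rho : Gamma -> aff K r, affine_realization c rho) /\
     (forall rho1 rho2 : Gamma -> aff K r,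
        affine_realization c rho1 -> affine_realization c rho2 ->
        same_class rho1 rho2))
  /\
  (exists Phi : nat -> nat, computable Phi /\
     forall (r : nat) (Gamma : groupType) (G : finGroupType)
            (c : crystal r Gamma G),
     exists d : nat,
       (forall (K : fieldType) (rho : Gamma -> aff K r),
          [pchar K] =i pred0 -> affine_realization c rho ->
          minimal_denominator rho d) /\
       (forall D : cryst_data, presented_by c D -> Phi (code_data D) = d)).
Proof.
split=> [r Gamma G c K charK | ].
  split; last exact: (realizations_same_class charK).
  have [D presD] := presented_exists c.
  have [d_gt0 [u u_ext] _] := min_denominatorP presD.
  by eexists; apply: scaled_realizationP charK d_gt0 u_ext.
(* By minimality the value does not depend on the data presenting [c], so that
   any choice [D0] of them may define [d]. *)
exists min_denominator; split; first exact: computable_min_denominator.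
move=> r Gamma G c.
have [D0 /min_denominatorP[d_gt0 u_ext min_d]] := presented_exists c.
exists (min_denominator (code_data D0)); split=> [K rho charK rho_real | D].
  split=> // [|d' d'_gt0 obtained].
    exact/(class_obtained_viaP charK d_gt0 rho_real).
  by apply: min_d => //; apply/(class_obtained_viaP charK d'_gt0 rho_real).
case/min_denominatorP=> d'_gt0 u'_ext min_d'.
by apply/eqP; rewrite eqn_leq min_d // min_d'.
Qed.
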